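(* The linear programming bound cannot prove the optimality of the $(4,10,1/6)$ spherical code: there is no integer $d \ge 0$ and no polynomial $$F(x) = \sum_{k=0}^d f_k\, C^1_k(x)$$ with real coefficients $f_0,\dots,f_d$ such that all of the following hold: (a) $f_k \ge 0$ for all $k = 0,\dots,d$; (b) $f_0 > 0$; (c) $F(x) \le 0$ for all $x \in [-1,1/6]$; and $F(1)/f_0 = 10$.
   Context: $C^1_k$ denotes the Gegenbauer polynomial of degree $k$ with parameter $1$, normalized by $C^1_k(1) = 1$; explicitly $C^1_k(\cos\theta) = \frac{1}{k+1}\sum_{j=0}^k \cos((k-2j)\theta)$, i.e. $C^1_k = U_k/(k+1)$ with $U_k$ the Chebyshev polynomial of the second kind. An $(n,N,t)$ spherical code is an $N$-element subset of the unit sphere $S^{n-1} \subseteq \mathbb{R}^n$ in which every two distinct points have inner product at most $t$; it is optimal if there is no $(n,N,t')$ spherical code with $t'<t$. The linear programming bound (for $n=4$, $t=1/6$) states that whenever a polynomial $F$ satisfies (a), (b), (c), every $(4,N,1/6)$ spherical code satisfies $N \le F(1)/f_0$. The linear programming bound proves optimality of a $(4,10,1/6)$ spherical code when it is tight, i.e. when $F(1)/f_0 = 10$ for some such $F$. *)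

(* Defs.v *)
From mathcomp Require Import all_boot all_order all_algebra.
From mathcomp Require Import reals trigo.
From mathcomp Require Import ring.

Set Implicit Arguments.
Unset Strict Implicit.
Unset Printing Implicit Defensive.

Import Order.TTheory GRing.Theory Num.Theory.
Local Open Scope ring_scope.

(* The pair (U_k, U_{k+1}) of Chebyshev polynomials of the second kind:
   U_0 = 1, U_1 = 2X, U_{k+2} = 2X U_{k+1} - U_k. *)
Fixpoint chebyshevU_pair (R : realType) (k : nat) : {poly R} * {poly R} :=
  if k is k'.+1 then
    let: (u, v) := chebyshevU_pair R k' in (v, 2%:R *: 'X * v - u)
  else (1, 2%:R *: 'X).

Definition chebyshevU (R : realType) (k : nat) : {poly R} :=
  (chebyshevU_pair R k).1.

(* Normalized so that C^1_k(1) = 1. *)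
Definition gegenbauer1 (R : realType) (k : nat) : {poly R} :=
  (k.+1%:R)^-1 *: chebyshevU R k.

Lemma chebyshevU0 (R : realType) : chebyshevU R 0 = 1.
Proof. by []. Qed.

Lemma chebyshevU1 (R : realType) : chebyshevU R 1 = 2%:R *: 'X.
Proof. by []. Qed.

Lemma chebyshevUSS (R : realType) (k : nat) :
  chebyshevU R k.+2 = 2%:R *: 'X * chebyshevU R k.+1 - chebyshevU R k.
Proof. by rewrite /chebyshevU /=; case: (chebyshevU_pair R k). Qed.

Lemma chebyshevU_cos (R : realType) (k : nat) (t : R) :
  (chebyshevU R k).[cos t] =
  \sum_(j < k.+1) cos ((k%:R - 2%:R * j%:R) * t).
Proof.
pose S n := \sum_(j < n.+1) cos ((n%:R - 2%:R * j%:R) * t).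
have SS n : S n.+2 = 2%:R * cos t * S n.+1 - S n.
  apply/eqP; rewrite eq_sym subr_eq; apply/eqP.
  rewrite /S mulr_sumr.
  under eq_bigr => j _.
    have -> : 2%:R * cos t * cos ((n.+1%:R - 2%:R * j%:R) * t) =
        cos ((n.+2%:R - 2%:R * j%:R) * t) + cos ((n%:R - 2%:R * j%:R) * t).
      have -> : (n.+2%:R - 2%:R * j%:R) * t =
        (n.+1%:R - 2%:R * j%:R) * t + t by rewrite -(natr1 n.+1); ring.
      have -> : (n%:R - 2%:R * j%:R) * t =
        (n.+1%:R - 2%:R * j%:R) * t - t by rewrite -(natr1 n); ring.
      by rewrite cosD cosB; ring.
    over.
  rewrite big_split /= [in RHS]big_ord_recr /=.
  rewrite [X in _ + X = _]big_ord_recr /= -addrA; congr (_ + _).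
  rewrite addrC; congr (_ + _); congr cos.
  by rewrite -!natr1; ring.
suff [] : (chebyshevU R k).[cos t] = S k /\
          (chebyshevU R k.+1).[cos t] = S k.+1 by [].
elim: k => [|k [IH0 IH1]].
  split; rewrite ?chebyshevU0 ?chebyshevU1 /S.
    by rewrite big_ord1 hornerE mulr0 subrr mul0r cos0.
  rewrite big_ord_recr big_ord1 /= !hornerE.
  have -> : (1 - 2%:R) * t = - t by ring.
  by rewrite cosN subr0 mul1r; ring.
by split=> //; rewrite chebyshevUSS SS -IH0 -IH1 !hornerE.
Qed.

Lemma gegenbauer1_cos (R : realType) (k : nat) (t : R) :
  (gegenbauer1 R k).[cos t] =
  (k.+1%:R)^-1 * \sum_(j < k.+1) cos ((k%:R - 2%:R * j%:R) * t).
Proof. by rewrite /gegenbauer1 hornerZ chebyshevU_cos. Qed.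

Lemma gegenbauer1_at1 (R : realType) (k : nat) : (gegenbauer1 R k).[1] = 1.
Proof.
rewrite -[X in _.[X]]cos0 gegenbauer1_cos.
under eq_bigr do rewrite mulr0 cos0.
by rewrite sumr_const card_ord mulVf ?pnatr_eq0.
Qed.

(* Main.v *)
Require Import Defs.
From mathcomp Require Import all_boot all_order all_algebra.
From mathcomp Require Import reals trigo.
From mathcomp Require Import ring lra.

Set Implicit Arguments.
Unset Strict Implicit.
Unset Printing Implicit Defensive.

Import Order.TTheory GRing.Theory Num.Theory.
Local Open Scope ring_scope.

(** The statement follows from linear programming duality.  Suppose that
    positive weights w_p at nodes x_p in [-1, 1/6], together with a unit mass
    at 1, form a measure whose integrals against all C^1_k with k > 0 are
    nonnegative.  Integrating F against this measure bounds F(1)/f_0 from below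
    by the total mass (lp_dual_bound), so a single such measure of mass
    greater than 10 excludes F(1)/f_0 = 10.

    The measure comes from quadrature.  The C^1_k are orthogonal with respect
    to the semicircle law sqrt(1 - x^2) dx.  A quadrature rule for that law on
    the nodes 1, 1/6 and c that is exact in degree at most 3 annihilates C^1_1,
    C^1_2 and C^1_3; exactness on (x - 1)(x - 1/6)(x - c) forces c = -7/10.
    Scaled to have weight 1 at the node 1, the rule has the weights 1377/208
    at 1/6 and 625/208 at -7/10, and total mass 85/8 > 10.

    It remains to see that its integrals against C^1_k are nonnegative for
    every k > 0 (nodes_dual_feasible).  Since |U_k(x)| <= (1 - x^2)^(-1/2)
    (chebyshevU_sqr_le), the two interior nodes contribute O(1/k) to the
    integral of C^1_k = U_k / (k + 1), and the node 1 contributes 1, so only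
    the integrals with k <= 10 need an explicit evaluation. *)

(** * Linear programming duality *)

(** F(1) + sum_p w_p F(x_p) is at most F(1), because F is nonpositive at the
    nodes; expanded in the C^1_k, it is at least its k = 0 term, because all
    the other terms are nonnegative. *)
Lemma lp_dual_bound (R : realType) (d : nat) (f : 'I_d.+1 -> R) (F : {poly R})
    (nodes : seq (R * R)) :
  F = \sum_(k < d.+1) f k *: gegenbauer1 R k ->
  (forall k, 0 <= f k) ->
  (forall p, p \in nodes -> 0 <= p.1 /\ F.[p.2] <= 0) ->
  (forall k, 0 <= 1 + \sum_(p <- nodes) p.1 * (gegenbauer1 R k.+1).[p.2]) ->
  f ord0 * (1 + \sum_(p <- nodes) p.1) <= F.[1].
Proof.
move=> FE f_ge0 nodesP dualP.
have hornerF x : F.[x] = \sum_(k < d.+1) f k * (gegenbauer1 R k).[x].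
  by rewrite FE horner_sum; under eq_bigr do rewrite hornerZ.
have nodes_le0 : \sum_(p <- nodes) p.1 * F.[p.2] <= 0.
  rewrite big_seq; apply: sumr_le0 => p /nodesP[w_ge0 Fp_le0].
  exact: mulr_ge0_le0.
have expansion : F.[1] + \sum_(p <- nodes) p.1 * F.[p.2] =
    \sum_(k < d.+1)
      f k * (1 + \sum_(p <- nodes) p.1 * (gegenbauer1 R k).[p.2]).
  under eq_bigr do rewrite hornerF mulr_sumr.
  rewrite exchange_big hornerF -big_split /=; apply: eq_bigr => k _.
  rewrite gegenbauer1_at1 mulrDr mulr_sumr; congr (_ + _).
  by apply: eq_bigr => p _; rewrite mulrCA.
suff : f ord0 * (1 + \sum_(p <- nodes) p.1) <=
    F.[1] + \sum_(p <- nodes) p.1 * F.[p.2].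
  by move=> /le_trans; apply; rewrite gerDl.
rewrite expansion big_ord_recl /=.
have C0 x : (gegenbauer1 R 0).[x] = 1.
  by rewrite /gegenbauer1 chebyshevU0 hornerZ hornerC invr1 mulr1.
under [in leRHS]eq_bigr do rewrite C0 mulr1.
rewrite lerDl; apply: sumr_ge0 => k _.
exact: mulr_ge0.
Qed.

(** * Chebyshev polynomials at a fixed point *)

Lemma horner_chebyshevU0 (R : realType) (x : R) : (chebyshevU R 0).[x] = 1.
Proof. by rewrite chebyshevU0 hornerC. Qed.

Lemma horner_chebyshevU1 (R : realType) (x : R) :
  (chebyshevU R 1).[x] = 2 * x.
Proof. by rewrite chebyshevU1 hornerZ hornerX. Qed.

Lemma horner_chebyshevUSS (R : realType) (k : nat) (x : R) :
  (chebyshevU R k.+2).[x] =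
  2 * x * (chebyshevU R k.+1).[x] - (chebyshevU R k).[x].
Proof. by rewrite chebyshevUSS !hornerE. Qed.

(** The quadratic form u^2 - 2 x u v + v^2 is invariant under the step
    (u, v) -> (v, 2 x v - u) of the recurrence. *)
Lemma chebyshevU_invariant (R : realType) (k : nat) (x : R) :
  (chebyshevU R k).[x] ^+ 2
    - 2 * x * (chebyshevU R k).[x] * (chebyshevU R k.+1).[x]
    + (chebyshevU R k.+1).[x] ^+ 2 = 1.
Proof.
elim: k => [|k IHk].
  by rewrite horner_chebyshevU0 horner_chebyshevU1; ring.
by rewrite -[RHS]IHk horner_chebyshevUSS; ring.
Qed.

(** Completing the square in the invariant form leaves (1 - x^2) U_k(x)^2. *)
Lemma chebyshevU_sqr_le (R : realType) (k : nat) (x : R) :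
  (1 - x ^+ 2) * (chebyshevU R k).[x] ^+ 2 <= 1.
Proof.
have := chebyshevU_invariant k x.
have := sqr_ge0 ((chebyshevU R k.+1).[x] - x * (chebyshevU R k).[x]).
lra.
Qed.

Lemma chebyshevU_norm_le (R : realType) (k : nat) (x c : R) :
  0 <= c -> 1 < (1 - x ^+ 2) * c ^+ 2 -> `|(chebyshevU R k).[x]| <= c.
Proof.
move=> c_ge0 c_big; rewrite leNgt; apply/negP => c_lt.
have Usqr := chebyshevU_sqr_le k x.
have sqr_lt : c ^+ 2 < (chebyshevU R k).[x] ^+ 2.
  by rewrite -[ltRHS]real_normK ?num_real// ltr_pXn2r// nnegrE.
have x_lt1 : 0 < 1 - x ^+ 2.
  have := le_lt_trans ler01 c_big.
  by rewrite ltNge => cpos; rewrite ltNge; apply: contra cpos => ?;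
     rewrite mulr_le0_ge0// sqr_ge0.
by have := ltr_pM2l x_lt1 (c ^+ 2) ((chebyshevU R k).[x] ^+ 2); rewrite sqr_lt;
   lra.
Qed.

(** * The dual measure *)

(** Pairs (weight, node); the unit mass at 1 is left implicit. *)
Definition dual_nodes (R : realType) : seq (R * R) :=
  [:: (625 / 208, - (7 / 10)); (1377 / 208, 1 / 6)].

(** The integrals of C^1_1, C^1_2 and C^1_3 are exactly 0, so no estimate can
    handle these degrees; from degree 11 on, the size bound on U suffices. *)
Lemma nodes_dual_feasible (R : realType) (k : nat) :
  0 <= 1 + \sum_(p <- dual_nodes R) p.1 * (gegenbauer1 R k.+1).[p.2].
Proof.
rewrite !big_cons big_nil /= /gegenbauer1 !hornerZ.
set a := (chebyshevU R k.+1).[_]; set b := (chebyshevU R k.+1).[_].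
have -> : 1 + (625 / 208 * (k.+2%:R^-1 * a)
      + (1377 / 208 * (k.+2%:R^-1 * b) + 0))
    = k.+2%:R^-1 * (k.+2%:R + 625 / 208 * a + 1377 / 208 * b).
  have : (k.+2%:R : R) != 0 by rewrite pnatr_eq0.
  by move: k.+2%:R => K K_neq0; field.
rewrite mulr_ge0 ?invr_ge0 ?ler0n// /a /b {a b}.
have [k_small|k_big] := ltnP k 10.
  pose x : R := - (7 / 10); pose y : R := 1 / 6.
  have x0 := horner_chebyshevU0 x; have x1 := horner_chebyshevU1 x.
  have y0 := horner_chebyshevU0 y; have y1 := horner_chebyshevU1 y.
  have xSS n := horner_chebyshevUSS n x; have ySS n := horner_chebyshevUSS n y.
  rewrite -/x -/y.
  by do 10![case: k k_small => [_|k k_small];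
    first by rewrite !(xSS, ySS, x0, x1, y0, y1) /x /y; lra].
(* Here k + 2 >= 12, while 625/208 * 3/2 + 1377/208 * 21/20 < 12. *)
have : `|(chebyshevU R k.+1).[- (7 / 10)]| <= 3 / 2.
  by apply: chebyshevU_norm_le; lra.
have : `|(chebyshevU R k.+1).[1 / 6]| <= 21 / 20.
  by apply: chebyshevU_norm_le; lra.
have : (12%:R : R) <= k.+2%:R by rewrite ler_nat.
rewrite !ler_norml => k12 /andP[b_ge _] /andP[a_ge _].
lra.
Qed.

Theorem mainTheorem2 (R : realType) :
  ~ exists (d : nat) (f : 'I_d.+1 -> R) (F : {poly R}),
      [/\ F = \sum_(k < d.+1) f k *: gegenbauer1 R k,
          (forall k : 'I_d.+1, 0 <= f k),
          0 < f ord0,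
          (forall x : R, -1 <= x <= 1 / 6%:R -> F.[x] <= 0)
        & F.[1] / f ord0 = 10%:R].
Proof.
move=> [d [f [F [FE f_ge0 f0_gt0 F_le0 FN]]]].
have nodesP p : p \in dual_nodes R -> 0 <= p.1 /\ F.[p.2] <= 0.
  by rewrite !inE => /orP[] /eqP-> /=; split;
     [lra | apply: F_le0; lra | lra | apply: F_le0; lra].
have := lp_dual_bound FE f_ge0 nodesP (@nodes_dual_feasible R).
rewrite !big_cons big_nil /= mulrC -ler_pdivlMr// FN.
lra.
Qed.
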